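(* Assume $\langle f\rangle_X=0$ and that $\psi$ satisfies (A1) and (A2). Let $u$ be the solution of the atomistic problem and $u^H$ the solution of the HQC problem. Then there exist constants $C_6,C_7$, depending only on $c_\psi,C_\psi,C'_\psi$ and $p$ (independent of $\epsilon$, $H$ and $f$), such that \[ \|u^H-u\|_{L^2}\le (C_6H^2+C_7\epsilon)\|f\|_{L^2}+\|e_{\rm mod}\|_{L^2}. \]
   Context: Let $\epsilon>0$, $N,p$ positive integers with $N/p\in\mathbb N$ and normalization $N\epsilon=1$; $X_i=\epsilon i$, $Y_j=j$. $U^N_{\rm per}(\epsilon\mathbb Z)$: functions $u:\epsilon\mathbb Z\to\mathbb R$ with $u(X_{i+N})=u(X_i)$; $U^N_\#(\epsilon\mathbb Z)$: those with $\langle u\rangle_X:=\frac1N\sum_{i=1}^Nu(X_i)=0$. $\langle u,v\rangle_X=\frac1N\sum_{i=1}^Nu(X_i)v(X_i)$, $Du(X_i)=(u(X_{i+1})-u(X_i))/\epsilon$, $\|u\|_{L^2}=\langle u,u\rangle_X^{1/2}$. $U^p_\#(\epsilon\mathbb Z)$: $p$-periodic functions on $\epsilon\mathbb Z$ with $\sum_{i=1}^p w(X_i)=0$. Two-scale functions $g:\epsilon\mathbb Z\times\mathbb Z\to\mathbb R$ satisfy $g(X_{i+N},Y_j)=g(X_i,Y_j)=g(X_i,Y_{j+p})$; $D_Xg(X_i,Y_j)=(g(X_{i+1},Y_j)-g(X_i,Y_j))/\epsilon$, $\langle g\rangle_Y(X_i)=\frac1p\sum_{j=1}^pg(X_i,Y_j)$,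 $\|g\|_{L^\infty(N,p)}=\max_{1\le i\le N,1\le j\le p}|g|$. $\psi$ is a two-scale function with (A1) $0<c_\psi\le\psi\le C_\psi$ and (A2) $\|D_X\psi\|_{L^\infty(N,p)}\le C'_\psi$. $\psi^\epsilon(X_i)=\psi(X_i,X_i/\epsilon)$, $\psi^0(X_i)=\langle1/\psi(X_i,\cdot)\rangle_Y^{-1}$. $f\in U^N_{\rm per}(\epsilon\mathbb Z)$. Atomistic problem: $u\in U^N_\#(\epsilon\mathbb Z)$ with $\langle\psi^\epsilon Du,Dv\rangle_X=\langle f,v\rangle_X$ for all $v\in U^N_{\rm per}(\epsilon\mathbb Z)$. HQC method: fix indices $1=i_1<\dots<i_K\le N$, $i_{K+1}=N+1$, elements $S_k=\{X_i:i_k\le i<i_{k+1}\}$, $H_k=\epsilon(i_{k+1}-i_k)$, $H=\max_kH_k$. $U^H_{\rm per}$: $v\in U^N_{\rm per}(\epsilon\mathbb Z)$ affine on each $\{X_i:i_k\le i\le i_{k+1}\}$; $U^H_\#=U^H_{\rm per}\cap U^N_\#(\epsilon\mathbb Z)$. In each $S_k$ choose a sampling domain $S_k^{\rm rep}=\{X_i:i_k^{\rm rep}\le i<i_k^{\rm rep}+p\}\subset S_k$ and a collocation index with $X_{i_k^{\rm coll}}\in S_k^{\rm rep}$; $\psi^\epsilon_{{\rm coll},k}(X_i)=\psi(X_{i_k^{\rm coll}},X_i/\epsilon)$, $\langle a,b\rangle_{S_k^{\rm rep}}=\frac1p\sum_{X_i\in S_k^{\rm rep}}a(X_i)b(X_i)$.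 For $v^H\in U^H_{\rm per}$ let $\ell_k$ be the affine function on $\epsilon\mathbb Z$ equal to $v^H$ on $S_k$; $\mathcal R_k(v^H)=\ell_k+w$ with $w\in U^p_\#(\epsilon\mathbb Z)$ such that $\langle\psi^\epsilon_{{\rm coll},k}D(\ell_k+w),Ds\rangle_{S_k^{\rm rep}}=0$ for all $s\in U^p_\#(\epsilon\mathbb Z)$. HQC problem: $u^H\in U^H_\#$ with $\sum_{k=1}^KH_k\langle\psi^\epsilon_{{\rm coll},k}D\mathcal R_k(u^H),D\mathcal R_k(v^H)\rangle_{S_k^{\rm rep}}=\langle f,v^H\rangle_X$ for all $v^H\in U^H_\#$. Modeling error: $e_{\rm mod}=u^H-\tilde u^H$, where $\tilde u^H\in U^H_\#$ solves $\langle\psi^0D\tilde u^H,Dv^H\rangle_X=\langle f,v^H\rangle_X$ for all $v^H\in U^H_\#$. *)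

(* Defs.v *)
From HB Require Import structures.
From mathcomp Require Import all_boot all_order all_algebra.
From mathcomp Require Import reals.
Set Implicit Arguments. Unset Strict Implicit. Unset Printing Implicit Defensive.
Import Order.TTheory GRing.Theory Num.Theory.
Local Open Scope ring_scope.

(* Conventions: a function on eps*Z is represented by its index function
   i |-> u(X_i), i : int.  A two-scale function g is represented by
   (i, j) |-> g(X_i, Y_j).  Mesh indices i_1,...,i_{K+1} are idx 0,...,idx K. *)

Section Defs.
Variable R : realType.

Definition periodic (N : nat) (u : int -> R) : Prop :=
  forall i : int, u (i + N%:Z) = u i.

Definition meanX (N : nat) (u : int -> R) : R :=
  N%:R^-1 * \sum_(1 <= i < N.+1) u i%:Z.

Definition innerX (N : nat) (u v : int -> R) : R :=
  N%:R^-1 * \sum_(1 <= i < N.+1) u i%:Z * v i%:Z.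

Definition L2 (N : nat) (u : int -> R) : R := Num.sqrt (innerX N u u).

Definition Dfw (eps : R) (u : int -> R) : int -> R :=
  fun i => (u (i + 1) - u i) / eps.

Definition UNsharp (N : nat) (u : int -> R) : Prop :=
  periodic N u /\ meanX N u = 0.

Definition Upsharp (p : nat) (w : int -> R) : Prop :=
  periodic p w /\ \sum_(1 <= i < p.+1) w i%:Z = 0.

Definition twoscale (N p : nat) (psi : int -> int -> R) : Prop :=
  forall i j : int, psi (i + N%:Z) j = psi i j /\ psi i (j + p%:Z) = psi i j.

Definition A1 (cpsi Cpsi : R) (psi : int -> int -> R) : Prop :=
  0 < cpsi /\ forall i j : int, cpsi <= psi i j <= Cpsi.

Definition A2 (N p : nat) (eps Cpsi' : R) (psi : int -> int -> R) : Prop :=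
  forall i j : nat, (1 <= i <= N)%N -> (1 <= j <= p)%N ->
    `|(psi (i%:Z + 1) j%:Z - psi i%:Z j%:Z) / eps| <= Cpsi'.

(* psi^eps(X_i) = psi(X_i, X_i/eps) = psi(X_i, Y_i) *)
Definition psi_eps (psi : int -> int -> R) : int -> R := fun i => psi i i.

Definition psi0 (p : nat) (psi : int -> int -> R) : int -> R :=
  fun i => (p%:R^-1 * \sum_(1 <= j < p.+1) (psi i j%:Z)^-1)^-1.

(* mesh: 1 = i_1 < ... < i_K <= N, i_{K+1} = N+1  (i_{k+1} = idx k) *)
Definition is_mesh (N K : nat) (idx : nat -> nat) : Prop :=
  (0 < K)%N /\ idx 0%N = 1%N /\ idx K = N.+1 /\
  forall k, (k < K)%N -> (idx k < idx k.+1)%N.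

(* sampling domains S_k^rep = {X_i : rep k <= i < rep k + p} subset S_k,
   collocation index coll k with X_{coll k} in S_k^rep *)
Definition is_sampling (p K : nat) (idx rep coll : nat -> nat) : Prop :=
  forall k, (k < K)%N ->
    [/\ (idx k <= rep k)%N, (rep k + p <= idx k.+1)%N &
        (rep k <= coll k < rep k + p)%N].

Definition Hk (eps : R) (idx : nat -> nat) (k : nat) : R :=
  eps * ((idx k.+1)%:R - (idx k)%:R).

Definition Hmax (eps : R) (K : nat) (idx : nat -> nat) : R :=
  \big[Num.max/0]_(k < K) Hk eps idx k.

Definition UHper (N K : nat) (idx : nat -> nat) (v : int -> R) : Prop :=
  periodic N v /\
  forall k, (k < K)%N -> forall i : int,
    ((idx k)%:Z <= i <= (idx k.+1)%:Z)%R ->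
    v i = v (idx k)%:Z +
          (i%:~R - (idx k)%:R) / ((idx k.+1)%:R - (idx k)%:R) *
          (v (idx k.+1)%:Z - v (idx k)%:Z).

Definition UHsharp (N K : nat) (idx : nat -> nat) (v : int -> R) : Prop :=
  UHper N K idx v /\ meanX N v = 0.

(* l_k : affine function on eps Z equal to v^H on the element k *)
Definition ell (idx : nat -> nat) (k : nat) (v : int -> R) : int -> R :=
  fun i => v (idx k)%:Z +
           (i%:~R - (idx k)%:R) / ((idx k.+1)%:R - (idx k)%:R) *
           (v (idx k.+1)%:Z - v (idx k)%:Z).

Definition innerRep (p : nat) (r : nat) (a b : int -> R) : R :=
  p%:R^-1 * \sum_(r <= i < r + p) a i%:Z * b i%:Z.

Definition psi_coll (psi : int -> int -> R) (c : nat) : int -> R :=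
  fun i => psi c%:Z i.

(* rk = R_k(v^H): rk = l_k + w, w in U^p_# solving the cell problem *)
Definition is_recon (p : nat) (eps : R) (psi : int -> int -> R)
    (idx rep coll : nat -> nat) (k : nat) (v rk : int -> R) : Prop :=
  exists w : int -> R,
    [/\ Upsharp p w,
        (forall s : int -> R, Upsharp p s ->
           innerRep p (rep k)
             (fun i => psi_coll psi (coll k) i *
                       Dfw eps (fun j => ell idx k v j + w j) i)
             (Dfw eps s) = 0) &
        rk = (fun i => ell idx k v i + w i)].

Definition atomistic_sol (N : nat) (eps : R) (psi : int -> int -> R)
    (f u : int -> R) : Prop :=
  UNsharp N u /\
  forall v : int -> R, periodic N v ->
    innerX N (fun i => psi_eps psi i * Dfw eps u i) (Dfw eps v) = innerX N f v.

(* HQC bilinear form sum_k H_k <psi_coll D R_k(u), D R_k(v)>_{S_k^rep},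
   given the reconstructions ru k = R_k(u), rv k = R_k(v) *)
Definition hqc_form (p : nat) (eps : R) (psi : int -> int -> R) (K : nat)
    (idx rep coll : nat -> nat) (ru rv : nat -> int -> R) : R :=
  \sum_(k < K) Hk eps idx k *
     innerRep p (rep k) (fun i => psi_coll psi (coll k) i * Dfw eps (ru k) i)
                        (Dfw eps (rv k)).

Definition hqc_sol (N p : nat) (eps : R) (psi : int -> int -> R) (K : nat)
    (idx rep coll : nat -> nat) (f uH : int -> R) : Prop :=
  UHsharp N K idx uH /\
  forall v : int -> R, UHsharp N K idx v ->
  forall ru rv : nat -> int -> R,
    (forall k, (k < K)%N -> is_recon p eps psi idx rep coll k uH (ru k)) ->
    (forall k, (k < K)%N -> is_recon p eps psi idx rep coll k v (rv k)) ->
    hqc_form p eps psi K idx rep coll ru rv = innerX N f v.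

Definition homog_sol (N p : nat) (eps : R) (psi : int -> int -> R) (K : nat)
    (idx : nat -> nat) (f ut : int -> R) : Prop :=
  UHsharp N K idx ut /\
  forall v : int -> R, UHsharp N K idx v ->
    innerX N (fun i => psi0 p psi i * Dfw eps ut i) (Dfw eps v) = innerX N f v.

End Defs.

(* Main.v *)
Require Import Defs.
From HB Require Import structures.
From mathcomp Require Import all_boot all_order all_algebra.
From mathcomp Require Import reals.
From mathcomp Require Import ring lra zify.
Import Order.TTheory GRing.Theory Num.Theory.
Local Open Scope ring_scope.

(* By the triangle inequality it is enough to bound [utH - u], so the HQC equations
   play no role.  Let [u0] solve the homogenized problem on the full lattice.  In one
   dimension both [u] and [u0] are given by a flux [sigma] with
   [sigma (i + 1) - sigma i = - eps * f (i + 1)], which is bounded by [L2 N f].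
   - [utH] is the Galerkin approximation of [u0], whose second difference quotient is
     controlled by [f]; duality gives the [H^2] term.
   - [Dfw (u - u0)] is, up to the constant difference of the two fluxes,
     [sigma0 i * (1 / psi i i - 1 / psi0 i)], which has mean zero over a period in the
     fast variable; summing by parts against a bounded corrector shows that its partial
     sums contribute only [O(eps)]. *)

(** * Periodic functions on the integers *)

Lemma periodic_mulz {R : realType} {N : nat} {u : int -> R} :
  periodic N u -> forall i q : int, u (i + q * N%:Z) = u i.
Proof.
move=> pu; have pn (n : nat) (i : int) : u (i + n%:Z * N%:Z) = u i.
  elim: n i => [|n IHn] i; first by rewrite mul0r addr0.
  by rewrite intS mulrDl mul1r addrA IHn pu.
move=> i [n|n]; first exact: pn.
by rewrite NegzE -[LHS](pn n.+1) mulNr subrK.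
Qed.

(** The representative is chosen before the function, so that one [n] serves every periodic
    expression in [i]. The residue of [i - 1], raised by one, falls in the range [1..N] over which
    the sums run. *)
Lemma periodic_rep {N : nat} (i : int) : (0 < N)%N ->
  exists2 n : nat, (1 <= n <= N)%N &
    forall (R : realType) (u : int -> R), periodic N u -> u i = u n%:Z.
Proof.
move=> N0; have NZ : N%:Z != 0 by rewrite eqz_nat -lt0n.
have m0 := modz_ge0 (i - 1) NZ.
have mN : ((i - 1) %% N%:Z)%Z < N%:Z by rewrite ltz_pmod // ltz_nat.
exists `|((i - 1) %% N%:Z)%Z|%N.+1.
  by move: m0 mN; case: (_ %% _)%Z => //= m _; rewrite ltz_nat.
move=> R u pu; rewrite -[RHS](periodic_mulz pu _ ((i - 1) %/ N%:Z)%Z).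
congr (u _); rewrite intS (gez0_abs m0).
by rewrite -addrA [X in 1 + X]addrC -divz_eq addrC subrK.
Qed.

Lemma periodic_ext {R : realType} {N : nat} (x : nat -> R) : (0 < N)%N ->
  exists2 X : int -> R, periodic N X &
    forall n, (1 <= n <= N)%N -> X n%:Z = x n.
Proof.
move=> N0; exists (fun i => x `|((i - 1) %% N%:Z)%Z|%N.+1).
  by move=> i; rewrite addrAC modzDr.
case=> // n nN; rewrite intS [1 + _]addrC addrK modz_small //.
Qed.

(** [G] collects the partial sums of [g] over one period and is then repeated; the passage from [N]
    back to [1] is consistent because [g] sums to zero over the period. *)
Lemma periodic_antiderivative {R : realType} {N : nat} (g : int -> R) :
  (0 < N)%N -> periodic N g -> \sum_(1 <= i < N.+1) g i%:Z = 0 ->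
  exists2 G : int -> R, periodic N G & forall i, G (i + 1) = G i + g i.
Proof.
move=> N0 pg sg.
have [G pG GE] := periodic_ext (fun n => \sum_(1 <= l < n) g l%:Z) N0.
exists G => // i; have [n /andP[n1 nN] rep] := periodic_rep i N0.
apply/eqP; rewrite -subr_eq0; apply/eqP.
rewrite (rep _ (fun i => G (i + 1) - (G i + g i))); last first.
  by move=> j; rewrite addrAC !pG pg.
apply/eqP; rewrite subr_eq0 GE ?n1 // -big_nat_recr //= addrC -intS.
have [nltN|] := ltnP n N; first by rewrite GE.
move=> Nn; have -> : n = N by apply/eqP; rewrite eqn_leq nN.
by rewrite intS pG GE // sg big_geq.
Qed.

Lemma sum_periodic_shift {R : realType} {N : nat} (F : int -> R) :
  periodic N F ->
  \sum_(1 <= i < N.+1) F (i%:Z + 1) = \sum_(1 <= i < N.+1) F i%:Z.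
Proof.
move=> pF; case: N pF => [|N] pF; first by rewrite !big_geq.
rewrite [RHS]big_nat_recl // [LHS]big_nat_recr //= addrC; congr (_ + _).
  by rewrite addrC pF.
by apply: eq_bigr => i _; rewrite addrC -intS.
Qed.

(** * Finite sums, the discrete inner product and its norm *)

Lemma sumr_nat_ge0 {R : realType} (m n : nat) (F : nat -> R) :
  (forall i, (m <= i < n)%N -> 0 <= F i) -> 0 <= \sum_(m <= i < n) F i.
Proof. by move=> F0; rewrite big_nat; apply: sumr_ge0. Qed.

(** Lagrange's identity: the double sum of the squares of [F i - F j] is twice the difference of the
    two sides. *)
Lemma sqr_sumr_le {R : realType} (m n : nat) (F : nat -> R) : (m <= n)%N ->
  (\sum_(m <= i < n) F i) ^+ 2 <= (n - m)%:R * \sum_(m <= i < n) F i ^+ 2.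
Proof.
move=> mn; rewrite -subr_ge0.
have : 0 <= \sum_(m <= i < n) \sum_(m <= j < n) (F i - F j) ^+ 2.
  by apply: sumr_nat_ge0 => i _; apply: sumr_nat_ge0 => j _; apply: sqr_ge0.
have -> : \sum_(m <= i < n) \sum_(m <= j < n) (F i - F j) ^+ 2 =
  2 * ((n - m)%:R * \sum_(m <= i < n) F i ^+ 2 - (\sum_(m <= i < n) F i) ^+ 2).
  transitivity (\sum_(m <= i < n) ((n - m)%:R * F i ^+ 2
     + \sum_(m <= j < n) F j ^+ 2 - 2 * F i * \sum_(m <= j < n) F j)).
    apply: eq_bigr => i _.
    rewrite (eq_bigr (fun j => F i ^+ 2 + F j ^+ 2 - 2 * F i * F j)); last first.
      by move=> j _; ring.
    by rewrite sumrB big_split /= sumr_const_nat -mulr_sumr [(n - m)%:R * _]mulr_natl.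
  rewrite sumrB big_split /= sumr_const_nat -mulr_sumr -mulr_suml -mulr_sumr.
  by rewrite -mulr_natl; ring.
by rewrite pmulr_rge0.
Qed.

Lemma innerXDl {R : realType} (N : nat) (u v w : int -> R) :
  innerX N (fun i => u i + v i) w = innerX N u w + innerX N v w.
Proof.
by rewrite /innerX -mulrDr -big_split /=; under eq_bigr do rewrite mulrDl.
Qed.

Lemma innerXBl {R : realType} (N : nat) (u v w : int -> R) :
  innerX N (fun i => u i - v i) w = innerX N u w - innerX N v w.
Proof.
by rewrite /innerX -mulrBr -sumrB /=; under eq_bigr do rewrite mulrBl.
Qed.

Lemma innerXC {R : realType} (N : nat) (u v : int -> R) :
  innerX N u v = innerX N v u.
Proof. by rewrite /innerX; under eq_bigr do rewrite mulrC. Qed.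

Lemma eq_innerX {R : realType} (N : nat) (u u' v v' : int -> R) :
  (forall n, (1 <= n <= N)%N -> u n%:Z = u' n%:Z) ->
  (forall n, (1 <= n <= N)%N -> v n%:Z = v' n%:Z) ->
  innerX N u v = innerX N u' v'.
Proof.
by move=> eu ev; congr (_ * _); apply: eq_big_nat => i iN; rewrite eu ?ev.
Qed.

Lemma innerX_ge0 {R : realType} (N : nat) (u : int -> R) : 0 <= innerX N u u.
Proof.
apply: mulr_ge0; first by rewrite invr_ge0 ler0n.
by apply: sumr_nat_ge0 => i _; rewrite -expr2 sqr_ge0.
Qed.

Lemma sqr_L2 {R : realType} (N : nat) (u : int -> R) : L2 N u ^+ 2 = innerX N u u.
Proof. exact: sqr_sqrtr (innerX_ge0 N u). Qed.

Lemma L2_ge0 {R : realType} (N : nat) (u : int -> R) : 0 <= L2 N u.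
Proof. exact: sqrtr_ge0. Qed.
#[local] Hint Extern 0 (is_true _) => solve [exact: L2_ge0] : core.

Lemma eq_L2 {R : realType} (N : nat) (u v : int -> R) :
  (forall n, (1 <= n <= N)%N -> u n%:Z = v n%:Z) -> L2 N u = L2 N v.
Proof. by move=> e; congr (Num.sqrt _); apply: eq_innerX. Qed.

Lemma L2_le {R : realType} (N : nat) (u : int -> R) (M : R) : 0 <= M ->
  innerX N u u <= M ^+ 2 -> L2 N u <= M.
Proof. by move=> M0 uM; rewrite -(@ler_pXn2r _ 2) ?nnegrE // sqr_L2. Qed.

Lemma le_innerX {R : realType} (N : nat) (u v : int -> R) :
  (forall n, (1 <= n <= N)%N -> `|u n%:Z| <= `|v n%:Z|) ->
  innerX N u u <= innerX N v v.
Proof.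
move=> uv; apply: ler_wpM2l; first by rewrite invr_ge0 ler0n.
apply: ler_sum_nat => i iN; rewrite -!expr2 -[u _ ^+ 2]real_normK ?num_real //.
by rewrite -[v _ ^+ 2]real_normK ?num_real // lerXn2r ?nnegrE // uv.
Qed.

Lemma innerX_CauchySchwarz {R : realType} (N : nat) (u v : int -> R) :
  `|innerX N u v| <= L2 N u * L2 N v.
Proof.
have quad (t : R) : 0 <= innerX N u u + 2 * t * innerX N u v + t ^+ 2 * innerX N v v.
  have := innerX_ge0 N (fun i => u i + t * v i).
  congr (0 <= _); rewrite /innerX !mulrA -!(mulrC N%:R^-1) -!mulrA -!mulrDr.
  congr (_ * _); rewrite !mulrA !mulr_sumr -!big_split /=.
  by apply: eq_bigr => i _; ring.
rewrite -(@ler_pXn2r _ 2) ?nnegrE ?mulr_ge0 //.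
rewrite real_normK ?num_real // [(L2 N u * _) ^+ 2]exprMn !sqr_L2.
have [v0|v0] := eqVneq (innerX N v v) 0.
  have [->|uv0] := eqVneq (innerX N u v) 0; first by rewrite v0 expr0n /= mulr0.
  (* When [innerX N v v = 0] the expression in [quad] is affine in [t], and this [t] gives it the
     value [-1]. *)
  have := quad (- (innerX N u u + 1) / (2 * innerX N u v)).
  rewrite v0 mulr0 addr0 => h; exfalso; move: h; apply/negP; rewrite -ltNge.
  have -> : innerX N u u + 2 * (- (innerX N u u + 1) / (2 * innerX N u v)) *
    innerX N u v = -1 by field.
  by rewrite ltrN10.
have vp : 0 < innerX N v v by rewrite lt_def v0 innerX_ge0.
(* The minimiser of the quadratic in [t]. *)
have := quad (- innerX N u v / innerX N v v).
rewrite -(pmulr_rge0 _ vp) -subr_ge0; congr (0 <= _).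
by field.
Qed.

Lemma L2_triangle {R : realType} (N : nat) (u v : int -> R) :
  L2 N (fun i => u i + v i) <= L2 N u + L2 N v.
Proof.
apply: L2_le; first by rewrite addr_ge0.
rewrite innerXDl !(innerXC _ _ (fun i => _ + _)) !innerXDl sqrrD !sqr_L2.
have := le_trans (ler_norm _) (innerX_CauchySchwarz N u v).
by rewrite (innerXC N v u) mulr2n; lra.
Qed.

Lemma L2M_le {R : realType} (N : nat) (a u : int -> R) (M : R) : 0 <= M ->
  (forall n, (1 <= n <= N)%N -> `|a n%:Z| <= M) ->
  L2 N (fun i => a i * u i) <= M * L2 N u.
Proof.
move=> M0 aM; apply: L2_le; first by rewrite mulr_ge0.
rewrite exprMn sqr_L2.
have -> : M ^+ 2 * innerX N u u = innerX N (fun i => M * u i) (fun i => M * u i).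
  rewrite /innerX mulrCA mulr_sumr; congr (_ * _).
  by apply: eq_bigr => i _; ring.
apply: le_innerX => n nN; rewrite !normrM (ger0_norm M0).
by rewrite ler_wpM2r // aM.
Qed.

Lemma L2_le_sup {R : realType} (N : nat) (u : int -> R) (M : R) :
  (0 < N)%N -> 0 <= M ->
  (forall n, (1 <= n <= N)%N -> `|u n%:Z| <= M) -> L2 N u <= M.
Proof.
move=> N0 M0 uM; apply: L2_le => //.
apply: (@le_trans _ _ (innerX N (fun=> M) (fun=> M))).
  by apply: le_innerX => n /uM /le_trans; apply; apply: ler_norm.
rewrite /innerX sumr_const_nat subn1 /= -[M * M *+ N]mulr_natl mulKf //.
by rewrite pnatr_eq0 -lt0n.
Qed.

Lemma mean_abs_le_L2 {R : realType} (N : nat) (u : int -> R) : (0 < N)%N ->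
  N%:R^-1 * \sum_(1 <= i < N.+1) `|u i%:Z| <= L2 N u.
Proof.
move=> N0; have NR : 0 < N%:R :> R by rewrite ltr0n.
have := innerX_CauchySchwarz N (fun i => `|u i|) (fun=> 1).
have -> : L2 N (fun=> 1 : R) = 1.
  rewrite /L2 /innerX; under eq_bigr do rewrite mulr1.
  by rewrite sumr_const_nat subn1 /= mulVf ?sqrtr1 // gt_eqF.
rewrite mulr1 /innerX; under eq_bigr do rewrite mulr1.
move/(le_trans (ler_norm _))/le_trans; apply.
by apply: L2_le => //; rewrite sqr_L2; apply: le_innerX => n _; rewrite normr_id.
Qed.

(** * Oscillation, difference quotients and summation by parts *)

(** As the weighted sum of [s] vanishes, the total weight times [s i] equals the sum of
    [w j * (s i - s j)], an average of oscillations. *)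
Lemma norm_le_osc {R : realType} (m n : nat) (w s : nat -> R) (M : R) :
  (forall i, (m <= i < n)%N -> 0 < w i) ->
  \sum_(m <= i < n) w i * s i = 0 ->
  (forall i j, (m <= i < n)%N -> (m <= j < n)%N -> `|s i - s j| <= M) ->
  forall i, (m <= i < n)%N -> `|s i| <= M.
Proof.
move=> w0 ws0 osc i imn.
have W0 : 0 < \sum_(m <= j < n) w j.
  have/andP[mi ni] := imn.
  rewrite (big_cat_nat mi (ltnW ni)) /= (big_ltn ni) addrCA ltr_pwDl ?w0 //.
  by apply: addr_ge0; apply: sumr_nat_ge0 => j jmn; apply/ltW/w0; lia.
rewrite -(ler_pM2l W0) -{1}(gtr0_norm W0) -normrM.
have -> : (\sum_(m <= j < n) w j) * s i = \sum_(m <= j < n) w j * (s i - s j).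
  rewrite [RHS](eq_bigr (fun j => w j * s i - w j * s j)); last by move=> j _; ring.
  by rewrite sumrB ws0 subr0 mulr_suml.
apply: le_trans (ler_norm_sum _ _ _) _; rewrite mulr_suml.
apply: ler_sum_nat => j jmn; rewrite normrM (gtr0_norm (w0 j jmn)).
by rewrite ler_pM2l ?w0 // osc.
Qed.

Lemma osc_le_variation {R : realType} (m n : nat) (x : nat -> R) (i j : nat) :
  (m <= i <= n)%N -> (m <= j <= n)%N ->
  `|x i - x j| <= \sum_(m <= l < n) `|x l.+1 - x l|.
Proof.
wlog ji : i j / (j <= i)%N => [H|].
  by have [/H//|/ltnW/H h] := leqP j i => ? ?; rewrite distrC h.
move=> imn jmn; rewrite -telescope_sumr //.
apply: le_trans (ler_norm_sum _ _ _) _.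
have [mj ni] : (m <= j)%N /\ (i <= n)%N by lia.
rewrite (big_cat_nat mj (leq_trans ji ni)) /= (big_cat_nat ji ni) /=.
by rewrite addrCA lerDl addr_ge0 //; apply: sumr_nat_ge0.
Qed.

Lemma PoszS (n : nat) : n.+1%:Z = n%:Z + 1.
Proof. by rewrite intS addrC. Qed.

Lemma meanX_subr {R : realType} {N : nat} (u : int -> R) (c : R) : (0 < N)%N ->
  meanX N (fun i => u i - c) = meanX N u - c.
Proof.
move=> N0; rewrite /meanX sumrB sumr_const_nat subn1 /= mulrBr -[c *+ N]mulr_natl.
by rewrite mulKf // pnatr_eq0 -lt0n.
Qed.

Lemma sum_of_meanX0 {R : realType} {N : nat} (u : int -> R) : (0 < N)%N ->
  meanX N u = 0 -> \sum_(1 <= i < N.+1) u i%:Z = 0.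
Proof.
by move=> N0 /eqP; rewrite mulf_eq0 invr_eq0 pnatr_eq0 -[_ == _]negbK -lt0n N0 => /eqP.
Qed.

Lemma UNsharp_sub {R : realType} {N : nat} (u v : int -> R) :
  UNsharp N u -> UNsharp N v -> UNsharp N (fun i => u i - v i).
Proof.
move=> [pu mu] [pv mv]; split; first by move=> i; rewrite pu pv.
by move: mu mv; rewrite /meanX sumrB mulrBr => -> ->; rewrite subrr.
Qed.

Lemma Dfw_subr {R : realType} (eps c : R) (u : int -> R) (i : int) :
  Dfw eps (fun j => u j - c) i = Dfw eps u i.
Proof. by rewrite /Dfw; congr (_ / _); ring. Qed.

Lemma Dfw_sub {R : realType} (eps : R) (u v : int -> R) (i : int) :
  Dfw eps (fun j => u j - v j) i = Dfw eps u i - Dfw eps v i.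
Proof. by rewrite /Dfw -mulrBl; congr (_ / _); ring. Qed.

Lemma sum_Dfw_periodic {R : realType} {N : nat} (eps : R) (u : int -> R) :
  periodic N u -> \sum_(1 <= i < N.+1) Dfw eps u i%:Z = 0.
Proof.
by move=> pu; rewrite /Dfw -mulr_suml sumrB sum_periodic_shift // subrr mul0r.
Qed.

Lemma L2_periodic_shift {R : realType} {N : nat} (u : int -> R) :
  periodic N u -> L2 N (fun i => u (i + 1)) = L2 N u.
Proof.
move=> pu; congr (Num.sqrt (_ * _)).
by rewrite (sum_periodic_shift (fun i => u i * u i)) // => i; rewrite pu.
Qed.

(** Once [g * v] is shifted by one index, the two summands differ by an increment of the periodic
    function [sigma * v / eps], and these increments sum to zero. This turns a flux relation into
    the weak equation. *)
Lemma summation_by_parts {R : realType} {N : nat} (eps : R) (sigma g v : int -> R) :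
  eps != 0 -> periodic N sigma -> periodic N g -> periodic N v ->
  (forall i, sigma (i + 1) - sigma i = - eps * g (i + 1)) ->
  innerX N sigma (Dfw eps v) = innerX N g v.
Proof.
move=> e0 ps pg pv sg; congr (_ * _).
rewrite -[RHS](sum_periodic_shift (fun i => g i * v i)); last first.
  by move=> i; rewrite pg pv.
apply/eqP; rewrite -subr_eq0 -sumrB.
pose F i := sigma i * v i / eps.
have pF : periodic N F by move=> i; rewrite /F ps pv.
rewrite (eq_bigr (fun i : nat => F (i%:Z + 1) - F i%:Z)).
  by rewrite sumrB sum_periodic_shift // subrr.
move=> i _; rewrite /F /Dfw.
have -> : g (i%:Z + 1) = - (sigma (i%:Z + 1) - sigma i%:Z) / eps.
  by rewrite sg; field.
by field.
Qed.

(** A Poincare inequality: a vanishing weighted mean bounds [u] by its oscillation, hence by its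
    total variation, which is the mean of [Dfw eps u] in absolute value because [eps = 1 / N].
    General weights are allowed so that it also applies to fluxes, with weight [1 / alpha]. *)
Lemma sup_le_L2_Dfw {R : realType} {N : nat} (eps : R) (w u : int -> R) :
  (0 < N)%N -> 0 < eps -> N%:R * eps = 1 -> periodic N u ->
  (forall i, 0 < w i) -> \sum_(1 <= i < N.+1) w i%:Z * u i%:Z = 0 ->
  forall i : int, `|u i| <= L2 N (Dfw eps u).
Proof.
move=> N0 e0 Ne pu w0 wu i; have [n nN ->] := periodic_rep i N0 => //.
apply: (norm_le_osc 1 N.+1 (fun n => w n%:Z) (fun n => u n%:Z)) => // {n nN} j k jN kN.
apply: le_trans (osc_le_variation 1 N.+1 (fun n => u n%:Z) j k _ _) _; try lia.
have h (l : nat) : `|u l.+1 - u l| = eps * `|Dfw eps u l|.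
  rewrite /Dfw normrM [`|eps^-1|]gtr0_norm ?invr_gt0 // mulrCA mulfV ?gt_eqF //.
  by rewrite mulr1 PoszS.
under eq_bigr do rewrite h; rewrite -mulr_sumr.
have -> : eps = N%:R^-1 by apply: (mulfI (x := N%:R)); rewrite ?Ne ?divff // pnatr_eq0 -lt0n.
exact: mean_abs_le_L2.
Qed.

(** * One-dimensional elliptic problems through their fluxes *)

(** The equation is integrated twice: once for the flux, once for [z]. Each integration leaves a
    free constant; the first makes [z] periodic, the second gives it mean zero. *)
Lemma elliptic_solution {R : realType} {N : nat} (eps : R) (alpha g : int -> R) :
  (0 < N)%N -> 0 < eps -> periodic N alpha -> (forall i, 0 < alpha i) ->
  periodic N g -> meanX N g = 0 ->
  exists sigma z : int -> R,
    [/\ periodic N sigma, UNsharp N z,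
        (forall i, sigma (i + 1) - sigma i = - eps * g (i + 1)) &
        forall i, alpha i * Dfw eps z i = sigma i].
Proof.
move=> N0 e0 pa a0 pg mg.
have [||G pG GE] := @periodic_antiderivative R N (fun i => - eps * g (i + 1)) N0.
- by move=> i; rewrite addrAC pg.
- by rewrite -mulr_sumr sum_periodic_shift // sum_of_meanX0 // mulr0.
pose A := \sum_(1 <= i < N.+1) (alpha i%:Z)^-1.
(* The mean of [G] with weights [1 / alpha]: the only constant for which [(G - c) / alpha] sums to
   zero over a period. *)
pose c := (\sum_(1 <= i < N.+1) G i%:Z / alpha i%:Z) / A.
have A0 : 0 < A.
  rewrite /A big_ltn // ltr_pwDl ?invr_gt0 //.
  by apply: sumr_nat_ge0 => i _; rewrite invr_ge0 ltW.
have [||Z pZ ZE] := @periodic_antiderivative R N (fun i => eps * ((G i - c) / alpha i)) N0.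
- by move=> i; rewrite pG pa.
- rewrite -mulr_sumr; apply/eqP; rewrite mulf_eq0 gt_eqF //=; apply/eqP.
  under eq_bigr do rewrite mulrBl; rewrite sumrB -mulr_sumr /c.
  by rewrite -/A divfK ?subrr // gt_eqF.
exists (fun i => G i - c), (fun i => Z i - meanX N Z); split.
- by move=> i; rewrite pG.
- by split; [move=> i; rewrite pZ | rewrite meanX_subr // subrr].
- by move=> i; rewrite GE; ring.
- move=> i; rewrite Dfw_subr /Dfw ZE; have := a0 i; have := e0.
  by move=> /lt0r_neq0 ? /lt0r_neq0 ?; field; apply/andP.
Qed.

(** [sigma / alpha] is the difference quotient of a periodic function, so [sigma] has mean zero with
    weight [1 / alpha]; its own quotient is a shift of [g] up to sign, and the Poincare inequality
    applies. *)
Lemma flux_le {R : realType} {N : nat} (eps : R) (alpha g sigma z : int -> R) :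
  (0 < N)%N -> 0 < eps -> N%:R * eps = 1 -> (forall i, 0 < alpha i) ->
  periodic N g -> periodic N sigma -> periodic N z ->
  (forall i, sigma (i + 1) - sigma i = - eps * g (i + 1)) ->
  (forall i, alpha i * Dfw eps z i = sigma i) ->
  forall i, `|sigma i| <= L2 N g.
Proof.
move=> N0 e0 Ne a0 pg ps pz sg az i.
have <- : L2 N (Dfw eps sigma) = L2 N g.
  rewrite -(L2_periodic_shift g) //; congr (Num.sqrt (_ * _)); apply: eq_bigr => j _.
  have -> : Dfw eps sigma j = - g (j%:Z + 1).
    by rewrite /Dfw sg; field; rewrite gt_eqF.
  by rewrite mulrNN.
apply: (sup_le_L2_Dfw eps (fun i => (alpha i)^-1)) => //; first by move=> j; rewrite invr_gt0.
rewrite -[RHS](sum_Dfw_periodic (N := N) eps z) //; apply: eq_bigr => j _.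
by rewrite -az mulKf // gt_eqF.
Qed.

(** The discrete product rule for [Dfw eps z = sigma / alpha]: differencing [sigma] produces [g],
    with factor [A], and differencing [1 / alpha] produces a factor [L] times the flux, which
    [flux_le] bounds. *)
Lemma L2_Dfw2_le {R : realType} {N : nat} (eps A L : R) (alpha g sigma z : int -> R) :
  (0 < N)%N -> 0 < eps -> N%:R * eps = 1 -> (forall i, 0 < alpha i) ->
  periodic N g -> periodic N sigma -> periodic N z ->
  (forall i, sigma (i + 1) - sigma i = - eps * g (i + 1)) ->
  (forall i, alpha i * Dfw eps z i = sigma i) ->
  (forall i, (alpha i)^-1 <= A) ->
  (forall i, `|(alpha (i + 1))^-1 - (alpha i)^-1| <= eps * L) ->
  L2 N (Dfw eps (Dfw eps z)) <= (A + L) * L2 N g.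
Proof.
move=> N0 e0 Ne a0 pg ps pz sg az aA aL.
have ai0 i : 0 <= (alpha i)^-1 by rewrite invr_ge0 ltW.
have A0 : 0 <= A by apply: le_trans (aA 0).
have L0 : 0 <= L by rewrite -(pmulr_rge0 _ e0); apply: le_trans (aL 0).
have zE i : Dfw eps z i = (alpha i)^-1 * sigma i by rewrite -az mulKf ?gt_eqF.
rewrite (eq_L2 _ _ (fun i => - (alpha (i + 1))^-1 * g (i + 1)
    + ((alpha (i + 1))^-1 - (alpha i)^-1) / eps * sigma i)); last first.
  move=> n _; rewrite {1}/Dfw !zE.
  have -> : g (n%:Z + 1) = - (sigma (n%:Z + 1) - sigma n%:Z) / eps.
    by rewrite sg; field; rewrite gt_eqF.
  by have /lt0r_neq0 ? := e0; field; rewrite ?gt_eqF.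
apply: le_trans (L2_triangle _ _ _) _; rewrite mulrDl lerD //.
  rewrite -(L2_periodic_shift g) //.
  apply: (L2M_le _ (fun i => - (alpha (i + 1))^-1) (fun i => g (i + 1))) => // n _.
  by rewrite normrN ger0_norm.
apply: le_trans (L2M_le _ _ sigma L L0 _) _.
  move=> n _; rewrite normrM [`|eps^-1|]gtr0_norm ?invr_gt0 // ler_pdivrMr //.
  by rewrite mulrC.
rewrite ler_wpM2l //; apply: L2_le_sup => // n _.
exact: (flux_le eps alpha g sigma z).
Qed.

Lemma innerX_ge_coercive {R : realType} {N : nat} (c : R) (alpha u : int -> R) :
  (forall i, c <= alpha i) -> c * L2 N u ^+ 2 <= innerX N (fun i => alpha i * u i) u.
Proof.
move=> ca; rewrite sqr_L2 /innerX mulrCA ler_wpM2l ?invr_ge0 //.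
rewrite mulr_sumr; apply: ler_sum_nat => i _.
by rewrite -mulrA ler_wpM2r // -expr2 sqr_ge0.
Qed.

(** Testing both equations with the difference of the solutions, coercivity makes its difference
    quotient vanish; mean zero and the Poincare inequality conclude. *)
Lemma weak_solution_unique {R : realType} {N : nat} (eps c : R)
    (alpha g u u' : int -> R) :
  (0 < N)%N -> 0 < eps -> N%:R * eps = 1 -> 0 < c -> (forall i, c <= alpha i) ->
  UNsharp N u -> UNsharp N u' ->
  (forall v, periodic N v ->
     innerX N (fun i => alpha i * Dfw eps u i) (Dfw eps v) = innerX N g v) ->
  (forall v, periodic N v ->
     innerX N (fun i => alpha i * Dfw eps u' i) (Dfw eps v) = innerX N g v) ->
  forall i, u i = u' i.
Proof.
move=> N0 e0 Ne c0 ca Uu Uu' Hu Hu' i.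
have [pw mw] := UNsharp_sub _ _ Uu Uu'.
have D0 : L2 N (Dfw eps (fun i => u i - u' i)) <= 0.
  have := innerX_ge_coercive (N := N) c alpha (Dfw eps (fun i => u i - u' i)) ca.
  have -> : innerX N (fun i => alpha i * Dfw eps (fun i => u i - u' i) i)
                     (Dfw eps (fun i => u i - u' i)) = 0.
    rewrite (eq_innerX N _ (fun i => alpha i * Dfw eps u i - alpha i * Dfw eps u' i)
      _ (Dfw eps (fun i => u i - u' i))) //.
      by rewrite innerXBl Hu // Hu' // subrr.
    by move=> n _; rewrite Dfw_sub mulrBr.
  rewrite pmulr_rle0 // => h.
  by rewrite -(@ler_pXn2r _ 2) ?nnegrE // expr0n.
apply/eqP; rewrite -subr_eq0 -normr_le0; apply: (le_trans _ D0).
apply: (sup_le_L2_Dfw eps (fun=> 1) (fun i => u i - u' i)) => //.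
by under eq_bigr do rewrite mul1r; exact: (sum_of_meanX0 (fun i => u i - u' i)).
Qed.

(** * The mesh and nodal interpolation *)

Lemma mesh_le {N K : nat} {idx : nat -> nat} : is_mesh N K idx ->
  forall j k, (j <= k <= K)%N -> (idx j <= idx k)%N.
Proof.
move=> [_ [_ [_ inc]]] j k /andP[+ kK]; elim: k kK => [|k IHk] kK.
  by rewrite leqn0 => /eqP ->.
rewrite leq_eqVlt => /predU1P[-> //|]; rewrite ltnS => jk.
exact: leq_trans (IHk (ltnW kK) jk) (ltnW (inc k kK)).
Qed.

Lemma mesh_sum {R : realType} {N K : nat} {idx : nat -> nat} (F : nat -> R) :
  is_mesh N K idx ->
  \sum_(1 <= i < N.+1) F i = \sum_(k < K) \sum_(idx k <= i < idx k.+1) F i.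
Proof.
move=> mesh; have [_ [i0 [iK inc]]] := mesh.
rewrite -{1}i0 -iK.
have partial m : (m <= K)%N -> \sum_(idx 0%N <= i < idx m) F i =
    \sum_(k < m) \sum_(idx k <= i < idx k.+1) F i.
  elim: m => [|m IHm] mK; first by rewrite big_ord0 big_geq.
  rewrite big_ord_recr /= -IHm 1?ltnW // -big_cat_nat //=; last exact/ltnW/inc.
  by apply: (mesh_le mesh); rewrite leq0n ltnW.
exact: partial.
Qed.

(** Passes from values indexed by elements to values indexed by lattice points. Elements are
    disjoint, so a single term of the sum is active at a given point of an element. *)
Lemma mesh_slope {R : realType} {N K : nat} {idx : nat -> nat} (s : nat -> R) :
  is_mesh N K idx ->
  exists S : nat -> R,
    forall k, (k < K)%N -> forall n, (idx k <= n < idx k.+1)%N -> S n = s k.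
Proof.
move=> mesh; exists (fun n => \sum_(k < K | (idx k <= n < idx k.+1)%N) s k) => // k kK n kn.
rewrite (big_pred1 (Ordinal kK)) // => j /=.
apply/idP/eqP => [jn|->//]; apply/val_inj => /=.
have [jk|kj|//] := ltngtP j k.
  by have := mesh_le mesh j.+1 k; lia.
by have := mesh_le mesh k.+1 j; have := ltn_ord j; lia.
Qed.

(** A Poincare-Wirtinger inequality on one element: each deviation from the mean is at most the
    variation [T], and [T ^+ 2] is bounded by Cauchy-Schwarz. The difference reaching [d n] is
    included, so that the right-hand sums over all elements tile one full period. *)
Lemma variance_le {R : realType} (m n : nat) (d : nat -> R) (a : R) :
  (m < n)%N -> \sum_(m <= i < n) (d i - a) = 0 ->
  \sum_(m <= i < n) (d i - a) ^+ 2 <=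
    (n%:R - m%:R) ^+ 2 * \sum_(m <= i < n) (d i.+1 - d i) ^+ 2.
Proof.
move=> mn da; set T := \sum_(m <= i < n) `|d i.+1 - d i|.
have T2 : T ^+ 2 <= (n%:R - m%:R) * \sum_(m <= i < n) (d i.+1 - d i) ^+ 2.
  rewrite -natrB 1?ltnW //; apply: le_trans (sqr_sumr_le m n _ (ltnW mn)) _.
  rewrite ler_wpM2l // ler_sum_nat // => i _.
  by rewrite real_normK ?num_real.
have -> : (n%:R - m%:R : R) ^+ 2 * \sum_(m <= i < n) (d i.+1 - d i) ^+ 2
    = \sum_(m <= i < n) ((n%:R - m%:R) * \sum_(m <= i < n) (d i.+1 - d i) ^+ 2).
  by rewrite sumr_const_nat -[_ *+ (_ - _)]mulr_natl natrB 1?ltnW // mulrA.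
apply: ler_sum_nat => i imn; apply: le_trans T2.
rewrite -(real_normK (num_real (d i - a))) lerXn2r ?nnegrE //.
  by apply: sumr_nat_ge0.
apply: (norm_le_osc m n (fun=> 1) (fun i => d i - a)) => //.
  by under eq_bigr do rewrite mul1r.
move=> j k jmn kmn; rewrite opprB addrA subrK.
by apply: osc_le_variation; lia.
Qed.

Lemma Hk_bounds {R : realType} {N K : nat} {idx : nat -> nat} (eps : R) :
  0 <= eps -> is_mesh N K idx ->
  forall k, (k < K)%N -> 0 <= Hk eps idx k <= Hmax eps K idx.
Proof.
move=> e0 [_ [_ [_ inc]]] k kK; apply/andP; split.
  by rewrite mulr_ge0 // subr_ge0 ler_nat ltnW ?inc.
exact: (@le_bigmax _ R _ 0 (fun k : 'I_K => Hk eps idx k) (Ordinal kK)).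
Qed.

Lemma Hmax_ge0 {R : realType} {N K : nat} {idx : nat -> nat} (eps : R) :
  0 <= eps -> is_mesh N K idx -> 0 <= Hmax eps K idx.
Proof.
move=> e0 mesh; have [K0 _] := mesh.
by have /andP[/le_trans h /h] := Hk_bounds eps e0 mesh 0%N K0.
Qed.

(* [V] is the nodal interpolant of [z], shifted to mean zero. *)
Lemma mesh_interpolant {R : realType} {N K : nat} {idx : nat -> nat} (eps : R)
    (z : int -> R) :
  (0 < N)%N -> 0 < eps -> is_mesh N K idx -> periodic N z ->
  exists2 V : int -> R, UHsharp N K idx V &
    L2 N (fun i => Dfw eps z i - Dfw eps V i)
      <= Hmax eps K idx * L2 N (Dfw eps (Dfw eps z)).
Proof.
move=> N0 e0 mesh pz; have [K0 [i0 [iK inc]]] := mesh.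
(* [s k] is the increment of the interpolant per lattice step, so its slope in the scaled variable
   is [s k / eps]. *)
have [s sE] : exists s : nat -> R, forall k,
    s k = (z (idx k.+1)%:Z - z (idx k)%:Z) / ((idx k.+1)%:R - (idx k)%:R).
  by exists (fun k => (z (idx k.+1)%:Z - z (idx k)%:Z) / ((idx k.+1)%:R - (idx k)%:R)).
have w0 k : (k < K)%N -> 0 < (idx k.+1)%:R - (idx k)%:R :> R.
  by move=> kK; rewrite subr_gt0 ltr_nat inc.
(* The interpolant is built from its increments [X], equal to [s k] on element [k]. Over a period
   they telescope to the increment of the periodic [z], which is zero, so [X] has a periodic
   antiderivative [V]. *)
have [S SE] := mesh_slope s mesh.
have [X pX XE] := periodic_ext (R := R) S N0.
have idx1N k n : (k < K)%N -> (idx k <= n < idx k.+1)%N -> (1 <= n <= N)%N.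
  move=> kK; have := mesh_le mesh 0 k; have := mesh_le mesh k.+1 K; lia.
have XS k n : (k < K)%N -> (idx k <= n < idx k.+1)%N -> X n%:Z = s k.
  by move=> kK kn; rewrite XE ?(idx1N k) // (SE k).
have [||V pV VE] := @periodic_antiderivative R N X N0.
- exact: pX.
- rewrite (mesh_sum _ mesh) (eq_bigr (fun k : 'I_K =>
    z (idx k.+1)%:Z - z (idx k)%:Z)); last first.
    move=> k _; rewrite (eq_big_nat _ _ (F2 := fun=> s k)); last first.
      by move=> n; apply: XS.
    rewrite sumr_const_nat -[_ *+ (_ - _)]mulr_natl natrB 1?ltnW ?inc // mulrC sE divfK //.
    by rewrite gt_eqF ?w0.
  rewrite -(big_mkord xpredT (fun k => z (idx k.+1)%:Z - z (idx k)%:Z)).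
  rewrite (telescope_sumr (fun k => z (idx k)%:Z)) // iK i0.
  by rewrite intS pz subrr.
have Vaff k t : (k < K)%N -> (idx k + t <= idx k.+1)%N ->
    V (idx k + t)%:Z = V (idx k)%:Z + t%:R * s k.
  move=> kK; elim: t => [|t IHt] tk; first by rewrite addn0 mul0r addr0.
  rewrite addnS PoszS VE IHt 1?ltnW -?addnS // (XS k) //; last by lia.
  by rewrite -natr1; ring.
have VK k : (k < K)%N -> V (idx k.+1)%:Z - V (idx k)%:Z = 
    ((idx k.+1)%:R - (idx k)%:R) * s k.
  move=> kK; have ik := ltnW (inc k kK).
  by have := Vaff k (idx k.+1 - idx k)%N kK; rewrite subnKC // natrB // => ->; [ring|].
exists (fun i => V i - meanX N V).
  split; last by rewrite meanX_subr // subrr.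
  split=> [i|k kK i /andP[ki ik]]; first by rewrite pV.
  have [t it] : exists t : nat, i = (idx k + t)%:Z.
    by exists `|i - (idx k)%:Z|%N; lia.
  rewrite it Vaff //; last by move: ik; rewrite it lez_nat.
  rewrite (_ : V (idx k.+1)%:Z - meanX N V - _ = ((idx k.+1)%:R - (idx k)%:R) * s k).
    rewrite mulrA divfK ?gt_eqF ?w0 //.
    by rewrite -[(idx k + t)%:Z%:~R]/((idx k + t)%:R) natrD; ring.
  by rewrite -VK //; ring.
have HkE := Hk_bounds eps (ltW e0) mesh.
have Hmax0 := Hmax_ge0 eps (ltW e0) mesh.
apply: L2_le; first by rewrite mulr_ge0.
rewrite exprMn sqr_L2 /innerX mulrCA ler_wpM2l ?invr_ge0 //.
rewrite mulr_sumr !(mesh_sum _ mesh) ler_sum // => -[k kK] _ /=.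
pose d n := Dfw eps z n%:Z.
apply: (@le_trans _ _ (\sum_(idx k <= n < idx k.+1) (d n - s k / eps) ^+ 2)).
  apply: ler_sum_nat => n kn; rewrite -expr2 Dfw_subr {2}/Dfw VE (XS k) //.
  by rewrite [V _ + _]addrC addrK.
(* [s k / eps] is the mean of [Dfw eps z] over the element. Writing increments of [d] as [eps] times
   second quotients supplies the factor that turns the index length of the element into [Hk]. *)
apply: le_trans (variance_le _ _ _ _ (inc k kK) _) _.
  rewrite sumrB sumr_const_nat -[_ *+ (_ - _)]mulr_natl natrB 1?ltnW ?inc //.
  rewrite /d /Dfw -mulr_suml mulrA sE [_ * (_ / _)]mulrC divfK ?gt_eqF ?w0 //.
  under eq_bigr do rewrite -PoszS.
  by rewrite (telescope_sumr (fun n => z n%:Z)) ?subrr // ltnW ?inc.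
rewrite -mulr_sumr.
have -> : (\sum_(idx k <= n < idx k.+1) (d n.+1 - d n) ^+ 2) =
   eps ^+ 2 * \sum_(idx k <= i < idx k.+1) Dfw eps (Dfw eps z) i * Dfw eps (Dfw eps z) i.
  rewrite mulr_sumr; apply: eq_bigr => n _; rewrite /d PoszS.
  rewrite -[Dfw eps (Dfw eps z) n%:Z]/((Dfw eps z (n%:Z + 1) - Dfw eps z n%:Z) / eps).
  by field; rewrite gt_eqF.
rewrite mulrA ler_wpM2r //.
  by apply: sumr_nat_ge0 => n _; rewrite -expr2 sqr_ge0.
have /andP[H0 HH] := HkE k kK.
by rewrite -exprMn mulrC -/(Hk eps idx k) lerXn2r ?nnegrE.
Qed.

(** * Error of the Galerkin approximation *)

Lemma UHsharp_sub {R : realType} {N K : nat} {idx : nat -> nat} (u v : int -> R) :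
  UHsharp N K idx u -> UHsharp N K idx v -> UHsharp N K idx (fun i => u i - v i).
Proof.
move=> [[pu au] mu] [[pv av] mv].
have [pw mw] := UNsharp_sub u v (conj pu mu) (conj pv mv).
by split=> //; split=> // k kK i ik; rewrite (au k kK i ik) (av k kK i ik); ring.
Qed.

(* Aubin-Nitsche duality. *)
Lemma galerkin_L2_error {R : realType} {N K : nat} {idx : nat -> nat}
    (eps c C L : R) (alpha f sigma u ut : int -> R) :
  (0 < N)%N -> 0 < eps -> N%:R * eps = 1 -> 0 < c -> is_mesh N K idx ->
  periodic N alpha -> (forall i, c <= alpha i <= C) ->
  (forall i, `|(alpha (i + 1))^-1 - (alpha i)^-1| <= eps * L) ->
  periodic N f -> periodic N sigma -> UNsharp N u ->
  (forall i, sigma (i + 1) - sigma i = - eps * f (i + 1)) ->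
  (forall i, alpha i * Dfw eps u i = sigma i) ->
  UHsharp N K idx ut ->
  (forall v, UHsharp N K idx v ->
     innerX N (fun i => alpha i * Dfw eps ut i) (Dfw eps v) = innerX N f v) ->
  L2 N (fun i => ut i - u i)
    <= C ^+ 2 / c * (c^-1 + L) ^+ 2 * Hmax eps K idx ^+ 2 * L2 N f.
Proof.
move=> N0 e0 Ne c0 mesh pa ca aL pf ps Uu sf au Uut galerkin.
have ca1 i : c <= alpha i by case/andP: (ca i).
have a0 i : 0 < alpha i by apply: lt_le_trans (ca1 i).
have aC i : `|alpha i| <= C by rewrite gtr0_norm //; case/andP: (ca i).
have C0 : 0 <= C by apply: le_trans (aC 0).
have ai i : (alpha i)^-1 <= c^-1 by rewrite lef_pV2 ?posrE.
(* [M] times the norm of the load bounds the derivative error of the nodal interpolant; it carries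
   one power of [Hmax]. *)
set M := (c^-1 + L) * Hmax eps K idx.
have interp (g s z : int -> R) : periodic N g -> periodic N s -> periodic N z ->
    (forall i, s (i + 1) - s i = - eps * g (i + 1)) ->
    (forall i, alpha i * Dfw eps z i = s i) ->
    exists2 V : int -> R, UHsharp N K idx V &
      L2 N (fun i => Dfw eps z i - Dfw eps V i) <= M * L2 N g.
  move=> pg pS pz sg az; have [V UV zV] := mesh_interpolant eps z N0 e0 mesh pz.
  exists V => //; apply: le_trans zV _; rewrite /M [_ * Hmax _ _ _]mulrC -mulrA ler_wpM2l //.
    exact: Hmax_ge0 (ltW e0) mesh.
  exact: (L2_Dfw2_le eps c^-1 L alpha g s z).
have ae_le (x y : int -> R) :
    `|innerX N (fun i => alpha i * x i) y| <= C * L2 N x * L2 N y.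
  apply: le_trans (innerX_CauchySchwarz _ _ _) _.
  by rewrite ler_wpM2r // L2M_le.
pose e i := ut i - u i; have [[put _] mut] := Uut; have [pu mu] := Uu.
have [pe me] : UNsharp N e by apply: UNsharp_sub.
(* Galerkin orthogonality: [ut] and [u] satisfy the same equation against test functions of the mesh
   space. *)
have orth v : UHsharp N K idx v -> innerX N (fun i => alpha i * Dfw eps e i) (Dfw eps v) = 0.
  move=> Uv; have [[pv _] _] := Uv.
  rewrite (eq_innerX N _ (fun i => alpha i * Dfw eps ut i - sigma i) _ (Dfw eps v)) //.
    by rewrite innerXBl galerkin // (summation_by_parts eps sigma f) ?subrr // gt_eqF.
  by move=> n _; rewrite /e Dfw_sub mulrBr au.
have [W UW uW] := interp f sigma u pf ps pu sf au.
have M0 : 0 <= M.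
  rewrite mulr_ge0 //; last exact: Hmax_ge0 (ltW e0) mesh.
  have L0 : 0 <= L by rewrite -(pmulr_rge0 _ e0); apply: le_trans (aL 0).
  by rewrite addr_ge0 // invr_ge0 ltW.
have cancel (x y : R) : 0 <= x -> 0 <= y -> x ^+ 2 <= y * x -> x <= y.
  rewrite le_eqVlt => /predU1P[<- //|x0] y0.
  by rewrite expr2 ler_pM2r.
have ci0 : 0 <= c^-1 by rewrite invr_ge0 ltW.
(* Cea's argument: in [e = (ut - W) - (u - W)] the first part is orthogonal, so the energy of [e] is
   controlled by the interpolation error of [u]. *)
have De : L2 N (Dfw eps e) <= C / c * (M * L2 N f).
  apply: cancel => //; first exact: mulr_ge0 (mulr_ge0 C0 ci0) (mulr_ge0 M0 (L2_ge0 _ _)).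
  rewrite -(ler_pM2l c0); apply: le_trans (innerX_ge_coercive c alpha _ ca1) _.
  rewrite (eq_innerX N _ (fun i => alpha i * Dfw eps e i) _
    (fun i => Dfw eps (fun j => ut j - W j) i - (Dfw eps u i - Dfw eps W i))) //; last first.
    by move=> n _; rewrite /e !Dfw_sub; ring.
  rewrite innerXC innerXBl -!(innerXC _ (fun i => alpha i * _)).
  rewrite orth; last exact: UHsharp_sub.
  rewrite sub0r.
  apply: le_trans (ler_norm _) _; rewrite normrN; apply: le_trans (ae_le _ _) _.
  rewrite (_ : c * _ = C * L2 N (Dfw eps e) * (M * L2 N f)).
    by rewrite ler_wpM2l // mulr_ge0.
  by field; rewrite gt_eqF.
(* The dual problem, with the error [e] itself as load. *)
have [s [z [pS [pz mz] se az]]] := elliptic_solution eps alpha e N0 e0 pa a0 pe me.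
have [V UV zV] := interp e s z pe pS pz se az.
(* The squared norm of [e] is the energy product of [z] and [e]; orthogonality replaces [z] by
   [z - V]. The second factor [M] thus gained gives [Hmax ^+ 2]. *)
have ee : L2 N e ^+ 2 <= C * (C / c * (M * L2 N f)) * M * L2 N e.
  rewrite sqr_L2 -(summation_by_parts eps s e e) ?gt_eqF //.
  have -> : innerX N s (Dfw eps e) =
      innerX N (fun i => Dfw eps z i - Dfw eps V i) (fun i => alpha i * Dfw eps e i).
    rewrite innerXBl [X in _ = _ - X]innerXC orth // subr0.
    by congr (_ * _); apply: eq_bigr => i _; rewrite -az; ring.
  rewrite innerXC; apply: le_trans (ler_norm _) _; apply: le_trans (ae_le _ _) _.
  rewrite -[X in _ <= X]mulrA; apply: ler_pM => //; first by rewrite mulr_ge0.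
  by rewrite ler_wpM2l.
have := cancel _ _ _ _ ee; rewrite -/e /M => h.
apply: le_trans (h _ _) _ => //.
  exact: mulr_ge0 (mulr_ge0 C0 (mulr_ge0 (mulr_ge0 C0 ci0) (mulr_ge0 M0 (L2_ge0 _ _)))) M0.
by rewrite le_eqVlt; apply/orP; left; apply/eqP; ring.
Qed.

(** * Sums of oscillating terms *)

(** A vanishing sum over the period makes the partial sums periodic, so only those with at most [p]
    terms need a bound. *)
Lemma norm_sum_periodic_le {R : realType} (p : nat) (g : nat -> R) (B : R) :
  (0 < p)%N -> (forall j, g (j + p)%N = g j) -> \sum_(1 <= j < p.+1) g j = 0 ->
  (forall j, `|g j| <= B) ->
  forall j, `|\sum_(1 <= l < j) g l| <= p%:R * B.
Proof.
move=> p0 gp g0 gB.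
have B0 : 0 <= B by apply: le_trans (gB 0%N).
have shift j : \sum_(1 <= l < j.+1 + p) g l = \sum_(1 <= l < j.+1) g l.
  elim: j => [|j IHj]; first by rewrite add1n g0 big_geq.
  by rewrite addSn big_nat_recr //= IHj gp -big_nat_recr.
elim/ltn_ind => j IHj; have [jp|pj] := leqP j p.+1.
  apply: le_trans (ler_norm_sum _ _ _) _.
  apply: (@le_trans _ _ (\sum_(1 <= l < j) B)); first exact: ler_sum_nat.
  by rewrite sumr_const_nat -[_ *+ (_ - _)]mulr_natl ler_wpM2r // ler_nat; lia.
(* The successor form matters: [shift] starts at upper limit one, since at zero the empty sum need
   not equal the sum below [p]. *)
have -> : j = ((j - p).-1.+1 + p)%N by lia.
by rewrite shift; apply: IHj; lia.
Qed.

(* Abel summation against the corrector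
   [beta i j = \sum_(1 <= l < j) h i l], which is bounded since [h i] is periodic
   with mean zero: [h i i = beta i i.+1 - beta i i]. *)
Lemma norm_sum_oscillating_le {R : realType} (p m : nat) (h : nat -> nat -> R)
    (s : nat -> R) (B L S : R) :
  (0 < p)%N -> (0 < m)%N -> (forall i j, h i (j + p)%N = h i j) ->
  (forall i, \sum_(1 <= j < p.+1) h i j = 0) ->
  (forall i j, `|h i j| <= B) -> (forall i j, `|h i.+1 j - h i j| <= L) ->
  (forall i, `|s i| <= S) ->
  `|\sum_(1 <= i < m) s i * h i i| <=
    p%:R * (2 * (S * B) + B * \sum_(1 <= i < m) `|s i.+1 - s i| + m.-1%:R * (S * L)).
Proof.
move=> p0 m0 hp h0 hB hL sS.
pose beta i j := \sum_(1 <= l < j) h i l.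
have betaB i j : `|beta i j| <= p%:R * B by apply: norm_sum_periodic_le.
(* The slow increment of [h] is again periodic with zero sum in the fast index, so its partial sums
   obey the same bound. *)
have betaL i j : `|beta i.+1 j - beta i j| <= p%:R * L.
  rewrite /beta -sumrB; apply: (norm_sum_periodic_le p (fun l => h i.+1 l - h i l)) => //.
    by move=> l; rewrite !hp.
  by rewrite sumrB !h0 subrr.
have B0 : 0 <= B by apply: le_trans (hB 0%N 0%N).
have S0 : 0 <= S by apply: le_trans (sS 0%N).
have bound (x y X Y : R) : `|x| <= X -> `|y| <= Y -> `|x * y| <= X * Y.
  by move=> xX yY; rewrite normrM ler_pM.
(* Besides the boundary terms, the diagonal increment of [beta] leaves the variation of [s] and the
   drift of [beta] in its slow index; these match the three terms of the bound. *)
have -> : \sum_(1 <= i < m) s i * h i i = s m * beta m m - s 1%N * beta 1%N 1%N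
    - \sum_(1 <= i < m) ((s i.+1 - s i) * beta i.+1 i.+1
                         + s i * (beta i.+1 i.+1 - beta i i.+1)).
  rewrite -(telescope_sumr (fun i => s i * beta i i)) // -sumrB.
  apply: eq_big_nat => i /andP[i1 _].
  have -> : h i i = beta i i.+1 - beta i i by rewrite /beta big_nat_recr //= addrC addrK.
  by ring.
apply: le_trans (ler_normB _ _) _.
have T1 : `|s m * beta m m - s 1%N * beta 1%N 1%N| <= p%:R * (2 * (S * B)).
  apply: le_trans (ler_normB _ _) _.
  have := bound _ _ _ _ (sS m) (betaB m m).
  have := bound _ _ _ _ (sS 1%N) (betaB 1%N 1%N).
  by rewrite (mulrCA S p%:R); lra.
rewrite -addrA mulrDr; apply: lerD; first exact: T1.
apply: le_trans (ler_norm_sum _ _ _) _.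
have -> : p%:R * (B * (\sum_(1 <= i < m) `|s i.+1 - s i|) + m.-1%:R * (S * L)) =
   \sum_(1 <= i < m) (`|s i.+1 - s i| * (p%:R * B) + S * (p%:R * L)).
  rewrite big_split /= sumr_const_nat -mulr_suml subn1 -[_ *+ _]mulr_natl; ring.
apply: ler_sum_nat => i _; apply: le_trans (ler_normD _ _) _.
by apply: lerD; apply: bound.
Qed.

(** * The homogenized coefficient *)

Lemma mean_le {R : realType} (p : nat) (x : nat -> R) (M : R) : (0 < p)%N ->
  (forall j, x j <= M) -> p%:R^-1 * \sum_(1 <= j < p.+1) x j <= M.
Proof.
move=> p0 xM; have pR : 0 < p%:R :> R by rewrite ltr0n.
rewrite mulrC ler_pdivrMr //; apply: (@le_trans _ _ (\sum_(1 <= j < p.+1) M)).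
  by apply: ler_sum_nat.
by rewrite sumr_const_nat subn1 -[_ *+ _]mulr_natr.
Qed.

Lemma le_mean {R : realType} (p : nat) (x : nat -> R) (M : R) : (0 < p)%N ->
  (forall j, M <= x j) -> M <= p%:R^-1 * \sum_(1 <= j < p.+1) x j.
Proof.
move=> p0 xM; rewrite -lerN2 -mulrN -sumrN.
by apply: mean_le => // j; rewrite lerN2.
Qed.

Lemma psi0V {R : realType} (p : nat) (psi : int -> int -> R) (i : int) :
  (psi0 p psi i)^-1 = p%:R^-1 * \sum_(1 <= j < p.+1) (psi i j%:Z)^-1.
Proof. exact: invrK. Qed.

(** [psi0] is a harmonic mean: its inverse averages values lying between [C^-1] and [c^-1]. *)
Lemma psi0_bounds {R : realType} (p : nat) (c C : R) (psi : int -> int -> R) :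
  (0 < p)%N -> A1 c C psi -> forall i, c <= psi0 p psi i <= C.
Proof.
move=> p0 [c0 cC] i.
have psi_gt0 j : 0 < psi i j by apply: lt_le_trans (c0) _; case/andP: (cC i j).
have C0 : 0 < C by apply: lt_le_trans (psi_gt0 0) _; case/andP: (cC i 0).
have lo : C^-1 <= (psi0 p psi i)^-1.
  by rewrite psi0V; apply: le_mean => // j; rewrite lef_pV2 ?posrE //; case/andP: (cC i j%:Z).
have hi : (psi0 p psi i)^-1 <= c^-1.
  by rewrite psi0V; apply: mean_le => // j; rewrite lef_pV2 ?posrE //; case/andP: (cC i j%:Z).
have psi00 : 0 < psi0 p psi i.
  by rewrite -invr_gt0; apply: lt_le_trans lo; rewrite invr_gt0.
by apply/andP; split; rewrite -lef_pV2 ?posrE.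
Qed.

(** [A2] speaks of one period in each variable, to which periodicity reduces every pair of indices;
    the difference of inverses then costs a factor [1 / c ^+ 2]. *)
Lemma psiV_lipschitz {R : realType} (N p : nat) (eps c C C' : R)
    (psi : int -> int -> R) :
  (0 < N)%N -> (0 < p)%N -> 0 < eps -> twoscale N p psi -> A1 c C psi ->
  A2 N p eps C' psi ->
  forall i j, `|(psi (i + 1) j)^-1 - (psi i j)^-1| <= eps * (C' / c ^+ 2).
Proof.
move=> N0 p0 e0 per [c0 cC] lip i j.
have [n nN nE] := periodic_rep i N0; have [m mp mE] := periodic_rep j p0.
rewrite (mE R (fun j => `|(psi (i + 1) j)^-1 - (psi i j)^-1|)); last first.
  by move=> k; rewrite !(proj2 (per _ _)).
rewrite (nE R (fun i => `|(psi (i + 1) m%:Z)^-1 - (psi i m%:Z)^-1|)); last first.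
  by move=> k; rewrite addrAC !(proj1 (per _ _)).
have psi_ge k l : c <= psi k l by case/andP: (cC k l).
have psi_gt0 k l : 0 < psi k l by apply: lt_le_trans (psi_ge k l).
have := lip n m nN mp; rewrite normrM [`|eps^-1|]gtr0_norm ?invr_gt0 // ler_pdivrMr // => D.
have -> : (psi (n%:Z + 1) m%:Z)^-1 - (psi n%:Z m%:Z)^-1 =
    - (psi (n%:Z + 1) m%:Z - psi n%:Z m%:Z) / (psi (n%:Z + 1) m%:Z * psi n%:Z m%:Z).
  by field; rewrite !gt_eqF.
rewrite normrM normrN mulrA [eps * C']mulrC; apply: ler_pM => //.
rewrite gtr0_norm ?invr_gt0 ?mulr_gt0 // lef_pV2 ?posrE ?mulr_gt0 ?exprn_gt0 //.
by rewrite expr2; apply: ler_pM => //; apply: ltW.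
Qed.

Lemma psi0V_lipschitz {R : realType} (p : nat) (L : R) (psi : int -> int -> R) :
  (0 < p)%N -> (forall i j, `|(psi (i + 1) j)^-1 - (psi i j)^-1| <= L) ->
  forall i, `|(psi0 p psi (i + 1))^-1 - (psi0 p psi i)^-1| <= L.
Proof.
move=> p0 lip i; rewrite !psi0V -mulrBr -sumrB normrM ger0_norm ?invr_ge0 //.
apply: le_trans (mean_le p (fun j => `|(psi (i + 1) j%:Z)^-1 - (psi i j%:Z)^-1|) L p0 _).
  by rewrite ler_wpM2l ?invr_ge0 // ler_norm_sum.
by [].
Qed.

(** * Error of homogenization *)

Lemma homogenization_L2_error {R : realType} (N p : nat) (eps c C C' : R)
    (psi : int -> int -> R) (f sigma0 u0 sigma u : int -> R) :
  (0 < N)%N -> (0 < p)%N -> 0 < eps -> N%:R * eps = 1 ->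
  twoscale N p psi -> A1 c C psi -> A2 N p eps C' psi ->
  periodic N f -> periodic N sigma0 -> UNsharp N u0 -> UNsharp N u ->
  (forall i, sigma0 (i + 1) - sigma0 i = - eps * f (i + 1)) ->
  (forall i, psi0 p psi i * Dfw eps u0 i = sigma0 i) ->
  (forall i, sigma (i + 1) - sigma i = - eps * f (i + 1)) ->
  (forall i, psi_eps psi i * Dfw eps u i = sigma i) ->
  L2 N (fun i => u0 i - u i) <= 4 * p%:R * (6 / c + 2 * (C' / c ^+ 2)) * eps * L2 N f.
Proof.
move=> N0 p0 e0 Ne per HA1 HA2 pf ps0 Uu0 Uu sf0 au0 sf au.
have [c0 cC] := HA1; have b0 := psi0_bounds p c C psi p0 HA1.
set Lam := C' / c ^+ 2.
have lip := psiV_lipschitz N p eps c C C' psi N0 p0 e0 per HA1 HA2.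
have lip0 := psi0V_lipschitz p _ psi p0 lip.
have psi_gt0 i j : 0 < psi i j by apply: lt_le_trans c0 _; case/andP: (cC i j).
have psi0_gt0 i : 0 < psi0 p psi i by apply: lt_le_trans c0 _; case/andP: (b0 i).
have psiV_le i j : `|(psi i j)^-1| <= c^-1.
  by rewrite gtr0_norm ?invr_gt0 // lef_pV2 ?posrE //; case/andP: (cC i j).
have psi0V_le i : `|(psi0 p psi i)^-1| <= c^-1.
  by rewrite normfV gtr0_norm // lef_pV2 ?posrE //; case/andP: (b0 i).
have s0_le i : `|sigma0 i| <= L2 N f.
  exact: (flux_le eps (psi0 p psi) f sigma0 u0 N0 e0 Ne psi0_gt0 pf ps0 (proj1 Uu0)).
pose h (i j : nat) : R := (psi i%:Z j%:Z)^-1 - (psi0 p psi i%:Z)^-1.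
pose T m := \sum_(1 <= i < m) sigma0 i%:Z * h i i.
(* From [norm_sum_oscillating_le] with [B = 2 / c] and slow increment [2 * eps * Lam]: the boundary
   terms give [4 / c], the variation of [sigma0] gives [2 / c], and the drift gives [2 * Lam]. *)
pose K := p%:R * (6 / c + 2 * Lam) * L2 N f.
have TK m : (1 <= m <= N.+1)%N -> `|T m| <= K.
  move=> /andP[m1 mN].
  apply: le_trans (norm_sum_oscillating_le p m h (fun i => sigma0 i%:Z)
    (2 / c) (eps * (2 * Lam)) (L2 N f) p0 m1 _ _ _ _ _) _ => //.
  - by move=> i j; rewrite /h PoszD (proj2 (per _ _)).
  - move=> i; rewrite /h sumrB psi0V sumr_const_nat subn1 /=.
    by rewrite -[_ *+ p]mulr_natl mulVKf ?subrr // pnatr_eq0 -lt0n.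
  - move=> i j; apply: le_trans (ler_normB _ _) _.
    by have := psiV_le i%:Z j%:Z; have := psi0V_le i%:Z; lra.
  - move=> i j; rewrite /h PoszS.
    have -> : forall a b x y : R, a - b - (x - y) = (a - x) - (b - y) by move=> *; ring.
    apply: le_trans (ler_normB _ _) _.
    by have := lip i%:Z j%:Z; have := lip0 i%:Z; rewrite -/Lam; lra.
  rewrite /K -mulrA ler_wpM2l //.
  have V : \sum_(1 <= i < m) `|sigma0 i.+1%:Z - sigma0 i%:Z| <= L2 N f.
    have sE i : `|sigma0 i.+1%:Z - sigma0 i%:Z| = eps * `|f (i%:Z + 1)|.
      by rewrite PoszS sf0 normrM normrN (gtr0_norm e0).
    under eq_bigr do rewrite sE.
    apply: (@le_trans _ _ (\sum_(1 <= i < N.+1) eps * `|f (i%:Z + 1)|)).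
      rewrite (big_cat_nat m1 mN) /= lerDl.
      by apply: sumr_nat_ge0 => i _; rewrite mulr_ge0 // ltW.
    rewrite -mulr_sumr (sum_periodic_shift (fun i => `|f i|)); last by move=> i; rewrite pf.
    rewrite (_ : eps = N%:R^-1); first exact: mean_abs_le_L2.
    by apply: (mulfI (x := N%:R)); rewrite ?Ne ?divff // pnatr_eq0 -lt0n.
  have mNe : m.-1%:R * eps <= 1 by rewrite -[X in _ <= X]Ne (ler_wpM2r (ltW e0)) // ler_nat; lia.
  have Lam0 : 0 <= Lam.
    by rewrite -(pmulr_rge0 _ e0); apply: le_trans (lip 0 0).
  (* Up to [N] drift terms of size [eps] add up to order one, by [N%:R * eps = 1]. *)
  have W : m.-1%:R * (L2 N f * (eps * (2 * Lam))) <= L2 N f * (2 * Lam).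
    rewrite (_ : _ * _ = (m.-1%:R * eps) * (L2 N f * (2 * Lam))); last by ring.
    by apply: ler_piMl => //; apply: mulr_ge0 => //; apply: mulr_ge0.
  have V2 : 2 / c * \sum_(1 <= i < m) `|sigma0 i.+1%:Z - sigma0 i%:Z| <= 2 / c * L2 N f.
    by rewrite ler_wpM2l // divr_ge0 // ltW.
  by move: V2 W; rewrite !mulrDl; lra.
pose w i := u i - u0 i.
(* Both fluxes have the same increments, hence differ by a constant. *)
have [delta sE] : exists delta, forall n : nat, sigma n%:Z = sigma0 n%:Z + delta.
  exists (sigma 0 - sigma0 0); elim=> [|n IHn]; first by rewrite addrC subrK.
  rewrite PoszS; have := sf n%:Z; have := sf0 n%:Z; rewrite IHn; lra.
pose A m := \sum_(1 <= i < m) (psi i%:Z i%:Z)^-1.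
have wE m : (1 <= m)%N -> w m%:Z - w 1 = eps * (T m + delta * A m).
  move=> m1; rewrite -(telescope_sumr (fun n => w n%:Z)) //.
  rewrite /T /A mulr_sumr -big_split mulr_sumr /=.
  apply: eq_bigr => i _.
  have -> : w i.+1%:Z - w i%:Z = eps * (Dfw eps u i%:Z - Dfw eps u0 i%:Z).
    by rewrite /w /Dfw PoszS; field; rewrite gt_eqF.
  have -> : Dfw eps u i%:Z = (psi i%:Z i%:Z)^-1 * sigma i%:Z.
    by rewrite -au /psi_eps mulKf ?gt_eqF.
  have -> : Dfw eps u0 i%:Z = (psi0 p psi i%:Z)^-1 * sigma0 i%:Z.
    by rewrite -au0 mulKf ?gt_eqF.
  by rewrite sE /h; ring.
have A0 m : 0 <= A m by apply: sumr_nat_ge0 => i _; rewrite invr_ge0 ltW.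
have AN m : (1 <= m <= N.+1)%N -> A m <= A N.+1.
  move=> /andP[m1 mN]; rewrite /A (big_cat_nat m1 mN) /= lerDl.
  by apply: sumr_nat_ge0 => i _; rewrite invr_ge0 ltW.
have [pw mw] : UNsharp N w by apply: UNsharp_sub.
(* Periodicity of [w] at [N.+1] forces [delta * A N.+1 = - T N.+1], which controls the unknown
   [delta]. *)
have close : `|delta| * A N.+1 <= K.
  have := wE N.+1 isT; rewrite intS pw subrr => /esym/eqP.
  rewrite mulf_eq0 gt_eqF //= addrC addr_eq0 => /eqP dA.
  by rewrite -(ger0_norm (A0 N.+1)) -normrM dA normrN TK //= leqnn.
have w1 m : (1 <= m <= N.+1)%N -> `|w m%:Z - w 1| <= eps * (2 * K).
  move=> mN; have m1 : (1 <= m)%N by case/andP: mN.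
  rewrite wE // normrM (gtr0_norm e0) (ler_wpM2l (ltW e0)) //.
  apply: le_trans (ler_normD _ _) _; rewrite normrM (ger0_norm (A0 m)).
  have := TK m mN; have : `|delta| * A m <= `|delta| * A N.+1 by rewrite ler_wpM2l ?AN.
  by move: close; lra.
have K0 : 0 <= K by apply: le_trans (TK 1%N _).
(* The factor 4: [T] and [delta * A] contribute [K] each, and comparing two values of [w] through
   [w 1] doubles this. Mean zero then turns oscillation into a sup bound. *)
rewrite (_ : _ * L2 N f = eps * (4 * K)); last by rewrite /K; ring.
apply: L2_le_sup => //; first by apply: mulr_ge0 (ltW e0) _; apply: mulr_ge0.
move=> n nN; rewrite distrC.
apply: (norm_le_osc 1 N.+1 (fun=> 1) (fun n => w n%:Z)) => //.
  by under eq_bigr do rewrite mul1r; exact: (sum_of_meanX0 w).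
move=> i j iN jN.
have wi : `|w i%:Z - w 1| <= eps * (2 * K) by apply: w1; lia.
have wj : `|w j%:Z - w 1| <= eps * (2 * K) by apply: w1; lia.
have -> : w i%:Z - w j%:Z = (w i%:Z - w 1) - (w j%:Z - w 1) by ring.
by apply: le_trans (ler_normB _ _) _; lra.
Qed.

(** * Assembly of the estimate *)

Theorem theorem6p2 (R : realType) (p : nat) (cpsi Cpsi Cpsi' : R) :
  (0 < p)%N -> 0 < cpsi ->
  exists C6 C7 : R,
  forall (N : nat) (eps : R) (psi : int -> int -> R) (K : nat)
         (idx rep coll : nat -> nat) (f u uH utH : int -> R),
    (0 < N)%N -> (p %| N)%N -> 0 < eps -> N%:R * eps = 1 ->
    twoscale N p psi -> A1 cpsi Cpsi psi -> A2 N p eps Cpsi' psi ->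
    is_mesh N K idx -> is_sampling p K idx rep coll ->
    periodic N f -> meanX N f = 0 ->
    atomistic_sol N eps psi f u ->
    hqc_sol N p eps psi K idx rep coll f uH ->
    homog_sol N p eps psi K idx f utH ->
    L2 N (fun i => uH i - u i)
      <= (C6 * Hmax eps K idx ^+ 2 + C7 * eps) * L2 N f
         + L2 N (fun i => uH i - utH i).

Proof.
move=> p0 cpsi0; pose Lam := Cpsi' / cpsi ^+ 2.
exists (Cpsi ^+ 2 / cpsi * (cpsi^-1 + Lam) ^+ 2), (4 * p%:R * (6 / cpsi + 2 * Lam)).
move=> N eps psi K idx rep coll f u uH utH N0 pN e0 Ne per HA1 HA2 mesh _ pf mf.
move=> [Uu Hu] _ [Uut Hut].
have [_ cC] := HA1.
have b0 := psi0_bounds p cpsi Cpsi psi p0 HA1.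
have lip0 := psi0V_lipschitz p _ psi p0
  (psiV_lipschitz N p eps cpsi Cpsi Cpsi' psi N0 p0 e0 per HA1 HA2).
have psi0_gt0 i : 0 < psi0 p psi i by apply: lt_le_trans cpsi0 _; case/andP: (b0 i).
have psi0_per : periodic N (psi0 p psi).
  move=> i; congr ((_ * _)^-1); apply: eq_bigr => j _.
  by rewrite (proj1 (per _ _)).
have psi_ge i : cpsi <= psi_eps psi i by case/andP: (cC i i).
have psi_gt0 i : 0 < psi_eps psi i by apply: lt_le_trans (psi_ge i).
(* A shift by [N] moves both arguments on the diagonal; the fast one is absorbed because [p] divides
   [N]. *)
have psi_per : periodic N (psi_eps psi).
  move=> i; rewrite /psi_eps (proj1 (per _ _)); case/dvdnP: pN => k ->.
  rewrite PoszM; apply: (periodic_mulz (u := psi i)) => j.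
  by rewrite (proj2 (per _ _)).
have [sigma0 [u0 [ps0 Uu0 sf0 au0]]] :=
  elliptic_solution eps (psi0 p psi) f N0 e0 psi0_per psi0_gt0 pf mf.
have [sigma [v [ps Uv sf av]]] :=
  elliptic_solution eps (psi_eps psi) f N0 e0 psi_per psi_gt0 pf mf.
(* The given atomistic solution is identified with the one built from a flux, to which the
   homogenization estimate applies. *)
have uv i : u i = v i.
  apply: (weak_solution_unique eps cpsi (psi_eps psi) f u v N0 e0 Ne) => // w pw.
  rewrite -(summation_by_parts eps sigma f w) ?gt_eqF //.
  by apply: eq_innerX => // n _; rewrite av.
(* The three parts are the Galerkin error, the homogenization error and the modeling error. *)
apply: le_trans (_ : L2 N (fun i => (utH i - u0 i) + (u0 i - v i) + (uH i - utH i)) <= _).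
  rewrite le_eqVlt; apply/orP; left; apply/eqP; apply: eq_L2 => n _.
  by rewrite uv; ring.
apply: le_trans (L2_triangle _ _ _) _; rewrite lerD2r.
apply: le_trans (L2_triangle _ _ _) _; rewrite mulrDl lerD //.
  exact: (galerkin_L2_error eps cpsi Cpsi Lam (psi0 p psi) f sigma0).
exact: (homogenization_L2_error N p eps cpsi Cpsi Cpsi' psi f sigma0 u0 sigma).
Qed.
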